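(* For every non-negative integer $n$, the $\mathbb{F}_1$-module $\widehat{H}(\mathbb{P}\{n\})$ of the discrete projective geometry on $n$ points is isomorphic to the $n$-fold coproduct $\bigvee_n \mathrm{Dynk}$ of the Dynkin $\mathbb{F}_1$-module with itself.
   Context: Let $\mathcal{F}in_*$ be the category with objects $\underline{n}_+=\{0,1,\ldots,n\}$, $n\ge 0$, pointed at $0$, and basepoint-preserving functions. An $\mathbb{F}_1$-module is a functor $X\colon\mathcal{F}in_*\to\mathcal{S}et_*$ to pointed sets with $X(\underline{0}_+)$ a one-element set; morphisms are natural transformations; coproducts are computed objectwise as wedge sums of pointed sets. The Dynkin $\mathbb{F}_1$-module: $\mathrm{Dynk}(\underline{n}_+)$ is the set of Dynkin systems on $\underline{n}_+$, i.e. families $X$ of subsets of $\underline{n}_+$ containing $\varnothing$ and closed under complements and under unions of disjoint pairs (since the set is finite, closure under countable disjoint unions is automatic), pointed at the full power set. For a pointed function $\phi\colon\underline{n}_+\to\underline{m}_+$, $\mathrm{Dynk}(\phi)(X)=\{A\subseteq\underline{m}_+:\phi^{-1}(A)\in X\}$. A plasma is a set $X$ with a hyperoperation $\star\colon X\times X\to\mathcal{P}(X)$ (empty values allowed) and an element $0\in X$ (the weak identity) such that $x\star y=y\star x$ and $x\in x\star 0$ for all $x,y$. A morphism $(X,\star,0)\to(Y,\boxplus,e)$ is a function $f$ with $f(0)=e$ and $f(x\star x')\subseteq f(x)\boxplus f(x')$. $\mathrm{Plas}(X,Y)$ is the set of plasma morphisms, pointed by the constant morphism at the weak identity. The power set plasma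 $\mathcal{P}(n)$ is the power set of $\{1,\ldots,n\}$ with weak identity $\varnothing$ and $a\star b=\{a\cup b\}$ if $a\cap b=\varnothing$, while $a\star b$ is the empty family otherwise. A pointed function $\phi\colon\underline{n}_+\to\underline{m}_+$ induces the plasma morphism $\phi^{-1}\colon\mathcal{P}(m)\to\mathcal{P}(n)$. The $\mathbb{F}_1$-module $\widehat{H}M$ of a plasma $M$ is $\underline{n}_+\mapsto\mathrm{Plas}(\mathcal{P}(n),M)$, with $\phi$ acting by precomposition with $\phi^{-1}$. A combinatorial projective geometry is a set $G$ with a ternary collinearity relation $\ell$ satisfying: $(a,b,a)\in\ell$; if $(a,p,q),(b,p,q)\in\ell$ and $p\neq q$ then $(a,b,p)\in\ell$; if $(p,a,b),(p,c,d)\in\ell$ then some $q\in G$ has $(q,a,c),(q,b,d)\in\ell$. Its associated plasma has underlying set $G\sqcup\{0\}$, weak identity $0$, with $0\boxplus 0=\{0\}$; $x\boxplus 0=0\boxplus x=\{x\}$ and $x\boxplus x=\{x,0\}$ for $x\in G$; and $x\boxplus y=\{z\in G:(z,x,y)\in\ell\}\setminus\{x,y\}$ for $x\neq y$ in $G$. $\mathbb{P}\{n\}$ denotes the discrete geometry on $\{1,\ldots,n\}$, where $(x,y,z)\in\ell$ iff $|\{x,y,z\}|\le2$, and also its associated plasma. The $\mathbb{F}_1$-module of the geometry is $\widehat{H}$ of its associated plasma. *)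

(* Defs.v *)
From HB Require Import structures.
From mathcomp Require Import all_boot.
From mathcomp Require Import generic_quotient.
From mathcomp Require Import boolp classical_sets.

Set Implicit Arguments.
Unset Strict Implicit.
Unset Printing Implicit Defensive.

Local Open Scope quotient_scope.

Record pmap (X Y : pointedType) := Pmap {
  pmap_fun :> X -> Y;
  pmap_point : pmap_fun point = point }.

Definition pid (X : pointedType) : pmap X X := @Pmap X X id erefl.

Lemma pcomp_subproof (X Y Z : pointedType) (g : pmap Y Z) (f : pmap X Y) :
  (g \o f) point = point.
Proof. by rewrite /= !pmap_point. Qed.

Definition pcomp (X Y Z : pointedType) (g : pmap Y Z) (f : pmap X Y) :
  pmap X Z := Pmap (pcomp_subproof g f).

(* The object n_+ of Fin_* is ['I_n.+1], pointed at 0, and a morphism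
   n_+ -> m_+ is a [pmap]. *)
HB.instance Definition _ (n : nat) := isPointed.Build 'I_n.+1 ord0.

Record F1module := MkF1module {
  F1obj :> nat -> pointedType;
  F1map : forall n m : nat, pmap 'I_n.+1 'I_m.+1 -> pmap (F1obj n) (F1obj m);
  F1map_id : forall n, F1map (pid 'I_n.+1) =1 id;
  F1map_comp : forall n m k (psi : pmap 'I_m.+1 'I_k.+1)
    (phi : pmap 'I_n.+1 'I_m.+1), F1map (pcomp psi phi) =1 F1map psi \o F1map phi;
  F1obj0 : forall x : F1obj 0, x = point }.

Arguments F1map _ {n m} _.

Record F1hom (X Y : F1module) := MkF1hom {
  F1hom_at :> forall n : nat, pmap (X n) (Y n);
  F1hom_nat : forall n m (phi : pmap 'I_n.+1 'I_m.+1),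
    F1hom_at m \o F1map X phi =1 F1map Y phi \o F1hom_at n }.

Definition F1iso (X Y : F1module) : Prop :=
  exists (f : F1hom X Y) (g : F1hom Y X),
    forall n, cancel (f n) (g n) /\ cancel (g n) (f n).

(* The quotient of the disjoint union of the [X i] and of a one-point set [None]
   that identifies all the base points with [None]; the extra point makes the
   empty wedge a one-point set. *)
Section Wedge.
Variables (I : choiceType) (X : I -> pointedType).

Definition wedge_base (a : option {i : I & X i}) : bool :=
  if a is Some u then tagged u == point else true.

Definition wedge_rel (a b : option {i : I & X i}) : bool :=
  (a == b) || wedge_base a && wedge_base b.

Lemma wedge_rel_refl : reflexive wedge_rel.
Proof. by move=> a; rewrite /wedge_rel eqxx. Qed.

Lemma wedge_rel_sym : symmetric wedge_rel.
Proof. by move=> a b; rewrite /wedge_rel eq_sym andbC. Qed.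

Lemma wedge_rel_trans : transitive wedge_rel.
Proof.
move=> b a c; rewrite /wedge_rel => /predU1P[-> //|/andP[aP bP]].
by case/predU1P=> [<-|/andP[_ cP]]; rewrite ?aP ?bP ?cP orbT.
Qed.

Canonical wedge_equiv :=
  EquivRel wedge_rel wedge_rel_refl wedge_rel_sym wedge_rel_trans.

Definition wedge : Type := {eq_quot wedge_equiv}.

HB.instance Definition _ := Choice.copy wedge {eq_quot wedge_equiv}.
HB.instance Definition _ := Quotient.on wedge.
HB.instance Definition _ := isPointed.Build wedge (\pi_wedge None).

Definition wedge_in (i : I) (x : X i) : wedge :=
  \pi_wedge (Some (Tagged X x)).

Lemma wedge_in_point (i : I) : wedge_in (point : X i) = point.
Proof. by apply/eqmodP; apply/orP; right; rewrite /= eqxx. Qed.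

Lemma wedgeP (w : wedge) : w = point \/ exists i (x : X i), w = wedge_in x.
Proof.
rewrite -[w]reprK; case: (repr w) => [[i x]|]; last by left.
by right; exists i, x.
Qed.

End Wedge.

Section WedgeMap.
Variables (I : choiceType) (X Y : I -> pointedType).
Variable f : forall i, pmap (X i) (Y i).

Definition wedge_map_fun (w : wedge X) : wedge Y :=
  if repr w is Some u then wedge_in (f (tag u) (tagged u)) else point.

Lemma wedge_map_pi (a : option {i : I & X i}) :
  wedge_map_fun (\pi_(wedge X) a) =
  if a is Some u then wedge_in (f (tag u) (tagged u)) else point.
Proof.
rewrite /wedge_map_fun.
have base b : wedge_base b ->
    (if b is Some u then wedge_in (f (tag u) (tagged u)) else point)
    = point :> wedge Y.
  case: b => [[i x]|//] /= /eqP ->.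
  by rewrite pmap_point wedge_in_point.
have /eqmodP/predU1P[-> //|/andP[rP aP]] :
    \pi_(wedge X) (repr (\pi_(wedge X) a)) = \pi_(wedge X) a by rewrite reprK.
by rewrite base // base.
Qed.

Lemma wedge_map_point : wedge_map_fun point = point.
Proof. by rewrite [LHS]wedge_map_pi. Qed.

Definition wedge_map : pmap (wedge X) (wedge Y) := Pmap wedge_map_point.

Lemma wedge_mapE (i : I) (x : X i) : wedge_map (wedge_in x) = wedge_in (f i x).
Proof. exact: wedge_map_pi. Qed.

End WedgeMap.

Section F1Coproduct.
Variables (I : choiceType) (X : I -> F1module).

Definition F1coprod_obj (n : nat) : pointedType := wedge (fun i => X i n).
Definition F1coprod_map n m (phi : pmap 'I_n.+1 'I_m.+1) :
  pmap (F1coprod_obj n) (F1coprod_obj m) :=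
  wedge_map (fun i => F1map (X i) phi).

Lemma F1coprod_id n : F1coprod_map (pid 'I_n.+1) =1 id.
Proof.
move=> w; have [->|[i [x ->]]] := wedgeP w; first exact: pmap_point.
by rewrite wedge_mapE F1map_id.
Qed.

Lemma F1coprod_comp n m k (psi : pmap 'I_m.+1 'I_k.+1)
  (phi : pmap 'I_n.+1 'I_m.+1) :
  F1coprod_map (pcomp psi phi) =1 F1coprod_map psi \o F1coprod_map phi.
Proof.
move=> w; have [->|[i [x ->]]] := wedgeP w; first by rewrite /comp !pmap_point.
by rewrite /comp !wedge_mapE F1map_comp.
Qed.

Lemma F1coprod0 (w : F1coprod_obj 0) : w = point.
Proof.
have [->//|[i [x ->]]] := wedgeP w.
by rewrite [x]F1obj0 wedge_in_point.
Qed.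

Definition F1coprod : F1module := MkF1module F1coprod_id F1coprod_comp F1coprod0.

End F1Coproduct.

Definition is_dynkin (T : finType) (F : {set {set T}}) : bool :=
  [&& finset.set0 \in F, [forall A in F, (~: A)%SET \in F] &
      [forall A in F, forall B in F,
         [disjoint A & B] ==> ((A :|: B)%SET \in F)]].

Lemma is_dynkinP (T : finType) (F : {set {set T}}) :
  reflect [/\ finset.set0 \in F, forall A, A \in F -> (~: A)%SET \in F &
    forall A B, A \in F -> B \in F -> [disjoint A & B] -> (A :|: B)%SET \in F]
  (is_dynkin F).
Proof.
apply: (iffP and3P) => -[F0 FC FU]; split=> //.
- exact/forall_inP.
- by move=> A B AF BF; move/forall_inP/(_ A AF)/forall_inP/(_ B BF)/implyP: FU.
- exact/forall_inP.
- by apply/forall_inP=> A AF; apply/forall_inP=> B BF; apply/implyP; apply: FU.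
Qed.

Definition dynkin_system (n : nat) : Type :=
  {F : {set {set 'I_n.+1}} | is_dynkin F}.

Lemma is_dynkin_full (T : finType) : is_dynkin [set: {set T}]%SET.
Proof. by apply/is_dynkinP; split=> *; rewrite finset.in_setT. Qed.

HB.instance Definition _ n := Choice.on (dynkin_system n).
HB.instance Definition _ n := isPointed.Build (dynkin_system n)
  (exist _ [set: {set 'I_n.+1}]%SET (is_dynkin_full 'I_n.+1)).

Definition dynkin_push (T U : finType) (phi : T -> U) (F : {set {set T}}) :
  {set {set U}} := [set A : {set U} | (phi @^-1: A)%SET \in F]%SET.

Lemma is_dynkin_push (T U : finType) (phi : T -> U) (F : {set {set T}}) :
  is_dynkin F -> is_dynkin (dynkin_push phi F).
Proof.
move=> /is_dynkinP[F0 FC FU]; apply/is_dynkinP.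
split=> [|A|A B]; rewrite !inE ?preimset0 ?preimsetC ?preimsetU //.
  exact: FC.
move=> AF BF dAB; apply: FU => //.
have /eqP AB0 : (A :&: B)%SET == finset.set0 by rewrite setI_eq0.
by rewrite -setI_eq0 -preimsetI AB0 preimset0.
Qed.

Section Dynk.

Definition Dynk_map_fun n m (phi : pmap 'I_n.+1 'I_m.+1) (F : dynkin_system n) :
  dynkin_system m :=
  exist _ (dynkin_push phi (sval F)) (is_dynkin_push phi (svalP F)).

Lemma Dynk_map_point n m (phi : pmap 'I_n.+1 'I_m.+1) :
  Dynk_map_fun phi point = point.
Proof. by apply/val_inj/setP => A; rewrite !inE. Qed.

Definition Dynk_map n m (phi : pmap 'I_n.+1 'I_m.+1) :
  pmap (dynkin_system n) (dynkin_system m) := Pmap (Dynk_map_point phi).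

Lemma Dynk_id n : Dynk_map (pid 'I_n.+1) =1 id.
Proof.
move=> F; apply/val_inj/setP => A; rewrite inE /=.
by have -> : (id @^-1: A)%SET = A by apply/setP => i; rewrite inE.
Qed.

Lemma Dynk_comp n m k (psi : pmap 'I_m.+1 'I_k.+1)
  (phi : pmap 'I_n.+1 'I_m.+1) :
  Dynk_map (pcomp psi phi) =1 Dynk_map psi \o Dynk_map phi.
Proof.
move=> F; apply/val_inj/setP => A; rewrite !inE /=.
suff -> : ((psi \o phi) @^-1: A = phi @^-1: (psi @^-1: A))%SET by [].
by apply/setP => i; rewrite !inE.
Qed.

Lemma Dynk0 (F : dynkin_system 0) : F = point.
Proof.
apply/val_inj/setP => A; rewrite inE.
have /is_dynkinP[F0 FC _] := svalP F.
suff [->|->] : A = finset.set0 \/ A = (~: finset.set0)%SET.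
- exact: F0.
- exact: FC.
have [A0|A0] := boolP (ord0 \in A); [right|left];
  by apply/setP=> i; rewrite (ord1 i) !inE ?A0 ?(negPf A0).
Qed.

Definition Dynk : F1module := MkF1module Dynk_id Dynk_comp Dynk0.

End Dynk.

Record plasma := MkPlasma {
  plasma_sort :> Type;
  hop : plasma_sort -> plasma_sort -> set plasma_sort;
  pzero : plasma_sort;
  hopC : forall x y, hop x y = hop y x;
  hop0 : forall x, hop x pzero x }.

Arguments pzero {p}.

Record plas (X Y : plasma) := MkPlas {
  plas_fun :> X -> Y;
  plas0 : plas_fun pzero = pzero;
  plasM : forall x x' : X,
    (plas_fun @` hop x x' `<=` hop (plas_fun x) (plas_fun x'))%classic }.

Arguments plasM {X Y} _ x x'.

Lemma plas_ext (X Y : plasma) (f g : plas X Y) : f =1 g -> f = g.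
Proof.
case: f g => [f f0 fM] [g g0 gM] /= /funext fg; subst g.
by rewrite (Prop_irrelevance f0 g0) (Prop_irrelevance fM gM).
Qed.

Lemma plas_cst_subproof (X Y : plasma) (x x' : X) :
  ((fun=> pzero) @` hop x x' `<=` hop pzero (pzero : Y))%classic.
Proof. by move=> _ [z _ <-]; exact: hop0. Qed.

Definition plas_cst (X Y : plasma) : plas X Y :=
  @MkPlas X Y (fun=> pzero) erefl (@plas_cst_subproof X Y).

HB.instance Definition _ (X Y : plasma) := gen_eqMixin (plas X Y).
HB.instance Definition _ (X Y : plasma) := gen_choiceMixin (plas X Y).
HB.instance Definition _ (X Y : plasma) :=
  isPointed.Build (plas X Y) (plas_cst X Y).

Lemma plas_comp_subproof (X Y Z : plasma) (g : plas Y Z) (f : plas X Y)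
  (x x' : X) : ((g \o f) @` hop x x' `<=` hop (g (f x)) (g (f x')))%classic.
Proof.
by move=> _ [z zxx' <-]; apply: plasM; exists (f z) => //; apply: plasM; exists z.
Qed.

Lemma plas_comp0 (X Y Z : plasma) (g : plas Y Z) (f : plas X Y) :
  (g \o f) pzero = pzero.
Proof. by rewrite /= !plas0. Qed.

Definition plas_comp (X Y Z : plasma) (g : plas Y Z) (f : plas X Y) : plas X Z :=
  MkPlas (plas_comp0 g f) (@plas_comp_subproof X Y Z g f).

(* The set {1, ..., n} is ['I_n], embedded in n_+ = ['I_n.+1] by [lift ord0],
   whose value at i is i + 1. *)
Section PowerPlasma.
Variable n : nat.

Definition pow_hop (a b : {set 'I_n}) : set {set 'I_n} :=
  if [disjoint a & b] then [set (a :|: b)%SET]%classic else classical_sets.set0.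

Lemma pow_hopC a b : pow_hop a b = pow_hop b a.
Proof. by rewrite /pow_hop disjoint_sym finset.setUC. Qed.

Lemma pow_hop0 a : pow_hop a finset.set0 a.
Proof. by rewrite /pow_hop -setI_eq0 finset.setI0 eqxx finset.setU0. Qed.

Definition pow_plasma : plasma := MkPlasma pow_hopC pow_hop0.

End PowerPlasma.

Section PowerPreim.
Variables (n m : nat) (phi : pmap 'I_n.+1 'I_m.+1).

Definition pow_preim_fun (A : pow_plasma m) : pow_plasma n :=
  [set i : 'I_n | phi (lift ord0 i) \in lift ord0 @: (A : {set 'I_m})]%SET.

Lemma pow_preim0 : pow_preim_fun pzero = pzero.
Proof. by apply/setP => i; rewrite !inE imset0 inE. Qed.

Lemma pow_preimM (A B : pow_plasma m) :
  (pow_preim_fun @` hop A B `<=` hop (pow_preim_fun A) (pow_preim_fun B))%classic.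
Proof.
move=> _ [C + <-]; rewrite /= /pow_hop; case: ifPn => // dAB -> /=.
rewrite ifT; first by apply/setP => i; rewrite !inE imsetU inE.
rewrite -setI_eq0; apply/eqP/setP => i; rewrite !inE.
apply/negP => /andP[/imsetP[j jA ->] ].
rewrite mem_imset; last exact: lift_inj.
by rewrite (disjointFr dAB jA).
Qed.

Definition pow_preim : plas (pow_plasma m) (pow_plasma n) :=
  MkPlas pow_preim0 pow_preimM.

End PowerPreim.

Section Hhat.
Variable M : plasma.

Lemma Hhat_map_point n m (phi : pmap 'I_n.+1 'I_m.+1) :
  plas_comp (point : plas (pow_plasma n) M) (pow_preim phi) = point.
Proof. exact: plas_ext. Qed.

Definition Hhat_map n m (phi : pmap 'I_n.+1 'I_m.+1) :
  pmap (plas (pow_plasma n) M) (plas (pow_plasma m) M) :=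
  @Pmap _ _ (fun f => plas_comp f (pow_preim phi)) (Hhat_map_point phi).

Lemma Hhat_id n : Hhat_map (pid 'I_n.+1) =1 id.
Proof.
move=> f; apply: plas_ext => A /=; congr (f _); apply/setP => i.
by rewrite inE /= mem_imset //; exact: lift_inj.
Qed.

Lemma Hhat_comp n m k (psi : pmap 'I_m.+1 'I_k.+1)
  (phi : pmap 'I_n.+1 'I_m.+1) :
  Hhat_map (pcomp psi phi) =1 Hhat_map psi \o Hhat_map phi.
Proof.
move=> f; apply: plas_ext => A /=; congr (f _); apply/setP => i.
rewrite !inE /=; case: (unliftP ord0 (phi (lift ord0 i))) => [j ->|->].
  by rewrite mem_imset ?inE //; exact: lift_inj.
have /= -> := pmap_point psi.
by apply/imsetP/imsetP => -[j _ /eqP]; rewrite (negPf (neq_lift _ _)).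
Qed.

Lemma Hhat0 (f : plas (pow_plasma 0) M) : f = point.
Proof.
apply: plas_ext => A; rewrite -[RHS](plas0 f); congr (f _).
by apply/setP => -[].
Qed.

Definition Hhat : F1module := MkF1module Hhat_id Hhat_comp Hhat0.

End Hhat.

Record projgeom := MkProjgeom {
  geom_sort :> Type;
  coll : geom_sort -> geom_sort -> geom_sort -> Prop;
  coll_refl : forall a b, coll a b a;
  coll_exch : forall a b p q,
    coll a p q -> coll b p q -> p <> q -> coll a b p;
  coll_proj : forall a b c d p,
    coll p a b -> coll p c d -> exists q, coll q a c /\ coll q b d }.

Section GeomPlasma.
Variable G : projgeom.

Local Open Scope classical_set_scope.

Definition geom_hop (u v : option G) : set (option G) :=
  match u, v with
  | None, None => [set None]
  | Some x, None | None, Some x => [set Some x]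
  | Some x, Some y =>
      if `[< x = y >] then [set Some x; None]
      else Some @` ([set z | coll z x y] `\` [set x; y])
  end.

Lemma coll_sym (x y z : G) : x <> y -> coll z x y -> coll z y x.
Proof. by move=> xy zxy; apply: (coll_exch zxy _ xy); exact: coll_refl. Qed.

Lemma geom_hopC u v : geom_hop u v = geom_hop v u.
Proof.
case: u v => [x|] [y|] //=.
case: asboolP => [->|xy]; first by rewrite asboolT.
rewrite asboolF; last by move=> yx; exact: xy.
congr (_ @` _); rewrite [X in _ `\` X]setUC; congr (_ `\` _).
by apply/seteqP; split=> z /=; apply: coll_sym => // yx; exact: xy.
Qed.

Lemma geom_hop0 u : geom_hop u None u.
Proof. by case: u. Qed.

Definition geom_plasma : plasma := MkPlasma geom_hopC geom_hop0.

End GeomPlasma.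

Section DiscreteGeometry.
Variable n : nat.

Definition disc_coll (x y z : 'I_n) : Prop := #|[set x; y; z]%SET| <= 2.

Lemma disc_collE (x y z : 'I_n) :
  disc_coll x y z <-> [|| x == y, x == z | y == z].
Proof.
rewrite /disc_coll finset.setUC cardsU1 cards2 !inE ![z == _]eq_sym.
by case: (x == y); case: (x == z); case: (y == z).
Qed.

Lemma disc_refl a b : disc_coll a b a.
Proof. by apply/disc_collE; rewrite eqxx orbT. Qed.

Lemma disc_exch a b p q :
  disc_coll a p q -> disc_coll b p q -> p <> q -> disc_coll a b p.
Proof.
move=> /disc_collE h1 /disc_collE h2 /eqP/negPf pq; apply/disc_collE.
move: h1 h2; rewrite pq !orbF => /orP[/eqP ->|/eqP ->]; first by rewrite eqxx orbT.
by case/orP => /eqP ->; rewrite eqxx ?orbT.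
Qed.

Lemma disc_proj a b c d p : disc_coll p a b -> disc_coll p c d ->
  exists q, disc_coll q a c /\ disc_coll q b d.
Proof.
move=> /disc_collE h1 /disc_collE h2.
suff [q [h3 h4]] : exists q, [|| q == a, q == c | a == c] /\
    [|| q == b, q == d | b == d].
  by exists q; split; apply/disc_collE.
have exq q : [|| q == a, q == c | a == c] && [|| q == b, q == d | b == d] ->
    exists q, [|| q == a, q == c | a == c] /\ [|| q == b, q == d | b == d].
  by move=> /andP[]; exists q.
case/or3P: h1 => /eqP e1; case/or3P: h2 => /eqP e2;
  solve [ by apply: (exq a); rewrite -?e1 -?e2 ?e1 ?e2 !eqxx ?orbT
        | by apply: (exq b); rewrite -?e1 -?e2 ?e1 ?e2 !eqxx ?orbT
        | by apply: (exq c); rewrite -?e1 -?e2 ?e1 ?e2 !eqxx ?orbT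
        | by apply: (exq d); rewrite -?e1 -?e2 ?e1 ?e2 !eqxx ?orbT ].
Qed.

Definition disc_geom : projgeom := MkProjgeom disc_refl disc_exch disc_proj.

End DiscreteGeometry.

(* Main.v *)
From mathcomp Require Import boolp classical_sets.
From mathcomp Require Import all_boot.
From mathcomp Require Import generic_quotient.
Require Import Defs.

Set Implicit Arguments.
Unset Strict Implicit.
Unset Printing Implicit Defensive.

(** A plasma morphism f from the power set of {1, ..., k} to the discrete
geometry takes at most one nonzero value. Indeed two distinct points x and y
have empty hypersum, because the line that they span contains no third point.
If f A = x and f B = y, split A and B along their intersection: since x
belongs to the hypersum of f (A :&: B) and f (A :\: B), both of these lie in
{0, x}, and likewise f (A :&: B) lies in {0, y}; so f (A :&: B) = 0 when x <>
y, whence f (A :\: B) = x and f (B :\: A) = y, although these disjoint sets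
must have values with nonempty hypersum ([plas_pow_one_point]).

A nonconstant f therefore amounts to a point x and the family Z of the sets
that f sends to 0. The hypersums among 0 and x are 0 + 0 = {0}, 0 + x = {x}
and x + x = {x, 0}; so f is a morphism exactly when Z contains the empty set
and, for disjoint A and B, any two of A, B and A :|: B being in Z force the
third to be ([hop_line_pt]).

Such families Z are the traces of the Dynkin systems on {0, ..., k} on the
sets that avoid 0. Closure under complements determines a Dynkin system by its
trace, and turns the disjoint union of a set that contains 0 with one that
avoids it into a difference of nested sets that avoid it, which is what the
two-out-of-three rule controls ([traceK], [is_dynkin_of_trace]). The full
Dynkin system corresponds to the constant morphism at 0, for which the point x
is undetermined; this is the identification of base points made by the wedge.
All this commutes with preimages, and yields a map from the coproduct that is
bijective in each degree. *)

(** * Isomorphisms of F1-modules and maps out of coproducts *)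

Lemma F1iso_sym (X Y : F1module) : F1iso X Y -> F1iso Y X.
Proof. by case=> f [g fgK]; exists g, f => n; case: (fgK n). Qed.

(** The inverse bijections are automatically pointed and natural, so that it
suffices to construct one of the two morphisms. *)
Lemma F1iso_inj_surj (X Y : F1module) (f : F1hom X Y) :
  (forall n, injective (f n)) -> (forall n y, exists x, f n x = y) -> F1iso X Y.
Proof.
move=> f_inj f_surj; pose g n y : X n := sval (cid (f_surj n y)).
have gK n : cancel (g n) (f n) by move=> y; exact: (svalP (cid (f_surj n y))).
have fK n : cancel (f n) (g n) by move=> x; apply: f_inj; rewrite gK.
have g0 n : g n point = point by rewrite -(pmap_point (f n)) fK.
have g_nat n m (phi : pmap 'I_n.+1 'I_m.+1) :
    Pmap (g0 m) \o F1map Y phi =1 F1map X phi \o Pmap (g0 n).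
  move=> y /=; apply: (can_inj (fK m)); rewrite gK.
  by have /= -> := F1hom_nat f phi (g n y); rewrite gK.
by exists f, (MkF1hom g_nat) => n.
Qed.

(** The universal property of the wedge: a family of pointed maps into Z agrees
on the base points that are glued together. *)
Section WedgeDesc.
Variables (I : choiceType) (X : I -> pointedType) (Z : pointedType).
Variable h : forall i, pmap (X i) Z.

Definition wedge_desc_fun (w : wedge X) : Z :=
  if repr w is Some u then h (tag u) (tagged u) else point.

Lemma wedge_desc_pi (a : option {i : I & X i}) :
  wedge_desc_fun (\pi_(wedge X) a)%qT =
  if a is Some u then h (tag u) (tagged u) else point.
Proof.
rewrite /wedge_desc_fun.
have base b : wedge_base b ->
    (if b is Some u then h (tag u) (tagged u) else point) = point.
  by case: b => [[i x]|//] /= /eqP ->; rewrite pmap_point.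
have /eqmodP/predU1P[-> //|/andP[rP aP]] :
    (\pi_(wedge X) (repr (\pi_(wedge X) a)) = \pi_(wedge X) a)%qT.
  by rewrite reprK.
by rewrite !base.
Qed.

Lemma wedge_desc_point : wedge_desc_fun point = point.
Proof. exact: wedge_desc_pi. Qed.

Definition wedge_desc : pmap (wedge X) Z := Pmap wedge_desc_point.

Lemma wedge_descE i (x : X i) : wedge_desc (wedge_in x) = h i x.
Proof. exact: wedge_desc_pi. Qed.

End WedgeDesc.

Section F1CoprodDesc.
Variables (I : choiceType) (X : I -> F1module) (Z : F1module).
Variable h : forall i, F1hom (X i) Z.

Lemma F1coprod_desc_nat n m (phi : pmap 'I_n.+1 'I_m.+1) :
  wedge_desc (fun i => h i m) \o F1map (F1coprod X) phi =1
  F1map Z phi \o wedge_desc (fun i => h i n).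
Proof.
move=> w; have [->|[i [x ->]]] := wedgeP w; first by rewrite /comp !pmap_point.
rewrite /comp [F1map (F1coprod X) phi _]wedge_mapE !wedge_descE.
exact: F1hom_nat.
Qed.

Definition F1coprod_desc : F1hom (F1coprod X) Z := MkF1hom F1coprod_desc_nat.

End F1CoprodDesc.

(** * Dynkin systems and their traces *)

Definition two_of_three (a b c : bool) : bool :=
  [&& a && b ==> c, b && c ==> a & a && c ==> b].

Definition has_two_of_three (T : finType) (Z : {set {set T}}) : Prop :=
  forall A B : {set T}, [disjoint A & B] ->
    two_of_three (A \in Z) (B \in Z) (A :|: B \in Z).

(** Dynkin systems are closed under nested differences: if A and B are
disjoint, then B is the complement of the disjoint union of A with the
complement of A :|: B. *)
Lemma dynkin_has_two_of_three (T : finType) (F : {set {set T}}) :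
  is_dynkin F -> has_two_of_three F.
Proof.
move=> /is_dynkinP[_ FC FU].
have diff (A B : {set T}) :
    [disjoint A & B] -> A \in F -> A :|: B \in F -> B \in F.
  move=> dAB AF ABF.
  have -> : B = ~: (A :|: ~: (A :|: B)).
    apply/setP => x; rewrite !inE; have := disjointFr dAB (x := x).
    by case: (x \in A) => [->|_] //=; rewrite negbK.
  apply/FC/FU => //; first exact: FC.
  by rewrite disjoints_subset setCK subsetUl.
move=> A B dAB; apply/and3P; split; apply/implyP => /andP[].
- by move=> AF BF; apply: FU.
- by rewrite setUC; apply: diff; rewrite disjoint_sym.
- exact: diff.
Qed.

Section Trace.
Variable k : nat.
Implicit Types (F G : {set {set 'I_k.+1}}) (Z : {set {set 'I_k}}).

Definition trace F : {set {set 'I_k}} :=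
  [set A : {set 'I_k} | lift ord0 @: A \in F].

Lemma trace0 F : is_dynkin F -> set0 \in trace F.
Proof. by case/is_dynkinP=> F0 _ _; rewrite inE imset0. Qed.

(** A set that contains 0 is tested through its complement, which avoids 0. *)
Definition dynkin_of_trace Z : {set {set 'I_k.+1}} :=
  [set A : {set 'I_k.+1} |
    lift ord0 @^-1: (if ord0 \in A then ~: A else A) \in Z].

Lemma lift0_preimK (A : {set 'I_k.+1}) :
  ord0 \notin A -> lift ord0 @: (lift ord0 @^-1: A) = A.
Proof.
move=> A0; apply/setP => x; case: (unliftP ord0 x) => [j ->|->].
  by rewrite mem_imset ?inE //; exact: lift_inj.
by rewrite (negPf A0); apply/imsetP => -[j _ /eqP];
  rewrite (negPf (neq_lift _ _)).
Qed.

Lemma lift0_imK (A : {set 'I_k}) : lift ord0 @^-1: (lift ord0 @: A) = A.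
Proof. by apply/setP => i; rewrite inE mem_imset //; exact: lift_inj. Qed.

Lemma lift0_notin (A : {set 'I_k}) : ord0 \notin lift ord0 @: A.
Proof. by apply/imsetP => -[j _ /eqP]; rewrite (negPf (neq_lift _ _)). Qed.

Lemma trace_has_two_of_three F : is_dynkin F -> has_two_of_three (trace F).
Proof.
move=> /dynkin_has_two_of_three F23 A B dAB; rewrite !inE imsetU; apply: F23.
rewrite -setI_eq0 -imsetI; last by move=> i j _ _; apply: lift_inj.
by rewrite (disjoint_setI0 dAB) imset0.
Qed.

Lemma dynkin_of_traceK Z : trace (dynkin_of_trace Z) = Z.
Proof. by apply/setP => A; rewrite !inE (negPf (lift0_notin A)) lift0_imK. Qed.

Lemma traceK F : is_dynkin F -> dynkin_of_trace (trace F) = F.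
Proof.
move=> /is_dynkinP[_ FC _]; apply/setP => A; rewrite !inE.
case: ifPn => A0; last by rewrite lift0_preimK.
rewrite lift0_preimK; last by rewrite inE A0.
by apply/idP/idP => /FC //; rewrite setCK.
Qed.

Lemma trace_inj (F G : dynkin_system k) :
  trace (sval F) = trace (sval G) -> F = G.
Proof.
move=> FG; apply/val_inj => /=.
by rewrite -(traceK (svalP F)) FG traceK ?(svalP G).
Qed.

(** The case to check is the union of A, containing 0, with B, avoiding 0:
then ~: A is the disjoint union of B and ~: (A :|: B), all three avoiding 0,
and two of them being in the family forces the third to be. *)
Lemma is_dynkin_of_trace Z :
  set0 \in Z -> has_two_of_three Z -> is_dynkin (dynkin_of_trace Z).
Proof.
move=> Z0 Z23; apply/is_dynkinP; split=> [|A|A B].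
- by rewrite !inE preimset0.
- by rewrite !inE; case: (ord0 \in A); rewrite ?setCK.
have dpre (C D : {set 'I_k.+1}) :
    [disjoint C & D] -> [disjoint lift ord0 @^-1: C & lift ord0 @^-1: D].
  by rewrite -!setI_eq0 -preimsetI => /eqP ->; rewrite preimset0.
wlog B0 : A B / ord0 \notin B => [hw AF BF dAB|].
  have [B0|B0] := boolP (ord0 \in B); last exact: hw.
  by rewrite setUC; apply: hw; rewrite ?(disjointFl dAB B0) // disjoint_sym.
rewrite !inE (negPf B0) orbF; case: ifP => A0 AZ BZ dAB.
  have dBC : [disjoint B & ~: (A :|: B)].
    by rewrite disjoints_subset setCK subsetUr.
  have /and3P[_ _] := Z23 _ _ (dpre _ _ dBC); rewrite -preimsetU BZ.
  suff -> : B :|: ~: (A :|: B) = ~: A by rewrite AZ.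
  apply/setP => x; rewrite !inE; have := disjointFr dAB (x := x).
  by case: (x \in A) => [->|_] //=; rewrite orbN.
by have /and3P[+ _ _] := Z23 _ _ (dpre _ _ dAB); rewrite preimsetU AZ BZ.
Qed.

End Trace.

(** * Morphisms from power sets to the discrete geometry *)

Section DiscreteLine.
Variable n : nat.
Local Notation Pn := (geom_plasma (disc_geom n)).

(** The values 0 and x, coded by the truth value of being 0. *)
Definition line_pt (x : 'I_n) (a : bool) : Pn :=
  if a then None else Some x.

(** On {0, x}, the hyperoperation rules out exactly the triples that have a
single nonzero entry. *)
Lemma hop_line_pt x (a b c : bool) :
  hop (line_pt x a) (line_pt x b) (line_pt x c) <-> two_of_three a b c.
Proof.
by case: a; case: b; case: c; rewrite /= ?asboolT //=; intuition.
Qed.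

(** A line of the discrete geometry has only two points, so a nonempty
hypersum of two points forces them to coincide. *)
Lemma hop_disc_eq (x y : 'I_n) w :
  hop (Some x : Pn) (Some y) w -> x = y.
Proof.
rewrite /=; case: asboolP => // _ [z [/disc_collE + nz] _].
by case/or3P=> /eqP zE //; case: nz; [left|right].
Qed.

Lemma hop_summand (x : 'I_n) (u v : Pn) :
  hop u v (Some x) -> u = None \/ u = Some x.
Proof.
case: u => [y|]; last by left.
case: v => [z|]; last by case=> ->; right.
move=> yzx; have yz : y = z by apply: hop_disc_eq yzx.
by move: yzx; rewrite yz /= asboolT // => -[->|//]; right.
Qed.

Lemma hop_none (u v : Pn) : hop u None v -> v = u.
Proof. by case: u. Qed.

Section Morphism.
Variable k : nat.
Variable f : plas (pow_plasma k) Pn.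

Lemma plas_powU (A B : {set 'I_k}) :
  [disjoint A & B] -> hop (f A) (f B) (f (A :|: B)).
Proof.
move=> dAB; apply: (plasM f A B); exists (A :|: B) => //=.
by rewrite /pow_hop dAB.
Qed.

(** With x <> y, the value on A :&: B would be 0, which leaves the distinct
points x and y as values on the disjoint sets A :\: B and B :\: A. *)
Lemma plas_pow_one_point (A B : {set 'I_k}) (x y : 'I_n) :
  f A = Some x -> f B = Some y -> x = y.
Proof.
move=> fA fB.
have hA : hop (f (A :&: B)) (f (A :\: B)) (Some x).
  rewrite -fA -{3}(setID A B); apply: plas_powU.
  by rewrite -setI_eq0 setIDA setIAC -setIDA setDv setI0.
have hB : hop (f (A :&: B)) (f (B :\: A)) (Some y).
  rewrite -fB -{3}(setID B A) [A :&: B]setIC; apply: plas_powU.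
  by rewrite -setI_eq0 setIDA setIAC -setIDA setDv setI0.
have [fAB|fAB] := hop_summand hA.
  have dAB : [disjoint A :\: B & B :\: A].
    rewrite -setI_eq0; apply/eqP/setP => i; rewrite !inE.
    by case: (i \in A); rewrite ?andbF.
  move: hA hB; rewrite !fAB hopC => /hop_none hA; rewrite hopC => /hop_none hB.
  by have := plas_powU dAB; rewrite -hA -hB => /hop_disc_eq.
by case: (hop_summand hB); rewrite fAB // => -[].
Qed.

End Morphism.

Definition plas_zeros k (f : plas (pow_plasma k) Pn) :
  {set {set 'I_k}} := [set A : {set 'I_k} | ~~ isSome (f A)].

Definition line_fun k (x : 'I_n) (Z : {set {set 'I_k}}) (A : pow_plasma k) :
  Pn := line_pt x ((A : {set 'I_k}) \in Z).

Section LinePlas.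
Variables (k : nat) (x : 'I_n) (Z : {set {set 'I_k}}).
Hypotheses (Z0 : set0 \in Z) (Z23 : has_two_of_three Z).

Lemma line_fun0 : line_fun x Z pzero = pzero.
Proof. by rewrite /line_fun /= Z0. Qed.

Lemma line_funM (A B : pow_plasma k) :
  (line_fun x Z @` hop A B `<=` hop (line_fun x Z A) (line_fun x Z B))%classic.
Proof.
move=> _ [C + <-]; rewrite {1}/hop /= /pow_hop; case: ifPn => // dAB ->.
exact/hop_line_pt/Z23.
Qed.

Definition line_plas : plas (pow_plasma k) Pn :=
  MkPlas line_fun0 line_funM.

End LinePlas.

Lemma plas_zeros0 k (f : plas (pow_plasma k) Pn) :
  set0 \in plas_zeros f.
Proof. by rewrite inE (plas0 f : f set0 = None). Qed.

Lemma plas_line k (f : plas (pow_plasma k) Pn)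
    (A : {set 'I_k}) (x : 'I_n) : f A = Some x ->
  f =1 line_fun x (plas_zeros f).
Proof.
move=> fA B; rewrite /line_fun inE; case fB: (f B) => [y|] //.
by rewrite (plas_pow_one_point fA fB).
Qed.

Lemma plas_zeros_two_of_three k (f : plas (pow_plasma k) Pn)
    (A : {set 'I_k}) (x : 'I_n) : f A = Some x ->
  has_two_of_three (plas_zeros f).
Proof.
move=> /plas_line fE B C dBC; apply/(hop_line_pt x).
by have := plas_powU f dBC; rewrite !fE.
Qed.

(** * The comparison morphism *)

Section DynkinLine.
Variable x : 'I_n.

Definition dynkin_line_fun k (F : Dynk k) : Hhat Pn k :=
  line_plas x (trace0 (svalP F)) (trace_has_two_of_three (svalP F)).

Lemma dynkin_line_point k : dynkin_line_fun (point : Dynk k) = point.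
Proof. by apply: plas_ext => A; rewrite /= /line_fun !inE. Qed.

Lemma dynkin_line_nat k m (phi : pmap 'I_k.+1 'I_m.+1) :
  Pmap (dynkin_line_point m) \o F1map Dynk phi =1
  F1map (Hhat Pn) phi \o Pmap (dynkin_line_point k).
Proof.
move=> F; apply: plas_ext => A; rewrite /= /line_fun !inE; congr line_pt.
congr (in_mem _ _); apply/setP => i; rewrite inE.
case: (unliftP ord0 i) => [j ->|->].
  by rewrite mem_imset ?inE //; exact: lift_inj.
have /= -> := pmap_point phi.
by rewrite !(negPf (lift0_notin _)).
Qed.

Definition dynkin_line : F1hom Dynk (Hhat Pn) :=
  MkF1hom dynkin_line_nat.

End DynkinLine.

(** The zero set recovers the trace, hence the Dynkin system; the point is
recovered as well unless every set is sent to 0. *)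
Lemma dynkin_line_eq k (x y : 'I_n) (F G : Dynk k) :
  dynkin_line x k F = dynkin_line y k G -> F = G /\ (x = y \/ F = point).
Proof.
move=> /(congr1 (@plas_fun _ _)) eFG.
have FG A : line_fun x (trace (sval F)) A = line_fun y (trace (sval G)) A.
  exact: (congr1 (fun h => h A) eFG).
have tFG : trace (sval F) = trace (sval G).
  by apply/setP => A; have := FG A; rewrite /line_fun; do 2!case: (A \in _).
split; first exact: trace_inj.
have [->|/eqP xy] := eqVneq x y; [by left|right].
apply: trace_inj; apply/setP => A; rewrite [RHS]inE in_setT.
by have := FG A; rewrite /line_fun -tFG; case: (A \in _) => // -[].
Qed.

Lemma dynkin_line_surj k (f : Hhat Pn k) :
  f = point \/ exists x F, f = dynkin_line x k F.
Proof.
have [[A [x fA]]|f0] := pselect (exists A x, f A = Some x); last first.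
  left; apply: plas_ext => A; case fA: (f A) => [x|] //.
  by case: f0; exists A, x.
right; exists x.
have FD := is_dynkin_of_trace (plas_zeros0 f) (plas_zeros_two_of_three fA).
exists (exist (is_dynkin (T := 'I_k.+1)) _ FD).
by apply: plas_ext => B; rewrite (plas_line fA) /= /line_fun dynkin_of_traceK.
Qed.

End DiscreteLine.

Theorem theorem4p7 (n : nat) :
  F1iso (Hhat (geom_plasma (disc_geom n))) (F1coprod (fun _ : 'I_n => Dynk)).
Proof.
apply/F1iso_sym/(F1iso_inj_surj (f := F1coprod_desc (@dynkin_line n))) => k.
- have line_inj (i j : 'I_n) (F G : Dynk k) :
      dynkin_line i k F = dynkin_line j k G ->
    wedge_in (X := fun=> Dynk k) (i := i) F = wedge_in (i := j) G.
    by case/dynkin_line_eq=> <- [->//|->]; rewrite !wedge_in_point.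
  have line_inj0 (i : 'I_n) (F : Dynk k) :
      dynkin_line i k F = point ->
    wedge_in (X := fun=> Dynk k) (i := i) F = point.
    rewrite -(pmap_point (dynkin_line i k)) => /line_inj ->.
    exact: wedge_in_point.
  have descE (i : 'I_n) (F : Dynk k) :
      F1coprod_desc (@dynkin_line n) k (wedge_in (i := i) F) =
      dynkin_line i k F.
    exact: wedge_descE.
  move=> v w.
  have [->|[i [F ->]]] := wedgeP v; have [->|[j [G ->]]] := wedgeP w => //;
    rewrite ?descE ?[_ point]pmap_point.
  + by move/esym/line_inj0 ->.
  + exact: line_inj0.
  + exact: line_inj.
- move=> f; have [->|[i [F ->]]] := dynkin_line_surj f.
    by exists point; apply: pmap_point.
  by exists (wedge_in (X := fun=> Dynk k) (i := i) F); apply: wedge_descE.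
Qed.
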